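(* Let $H(x,p)=\sigma(x)m(|p|)$ for $(x,p)\in\mathbf{T}^N\times\mathbf{R}^N$, where $\sigma:\mathbf{T}^N\to(0,\infty)$ is continuous, $m:[0,\infty)\to(0,1)$ is Lipschitz continuous and strictly increasing, and $m(r)\to1$ as $r\to\infty$. Let $\overline{\sigma}=\max_{\mathbf{T}^N}\sigma$, $\underline{\sigma}=\min_{\mathbf{T}^N}\sigma$, $m_0=m(0)$, and assume that $\overline{\sigma}m_0>\underline{\sigma}$. Let $T>0$ and let $u_0:\mathbf{R}^N\to\mathbf{R}$ be bounded and Lipschitz continuous. For $\varepsilon>0$ let $u^\varepsilon\in C(\mathbf{R}^N\times[0,T))$ be the unique bounded viscosity solution of $$u^\varepsilon_t(x,t)+H\left(\frac{x}{\varepsilon},Du^\varepsilon(x,t)\right)=0\ \text{ in }\mathbf{R}^N\times(0,T),\qquad u^\varepsilon(x,0)=u_0(x)\ \text{ in }\mathbf{R}^N.$$ Then $u^\varepsilon$ does not have a locally uniformly convergent limit in $\mathbf{R}^N\times[0,T)$ as $\varepsilon\to0$; that is, there is no function $u:\mathbf{R}^N\times[0,T)\to\mathbf{R}$ to which $u^\varepsilon$ converges locally uniformly in $\mathbf{R}^N\times[0,T)$ as $\varepsilon\to0$.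
   Context: $\mathbf{T}^N=\mathbf{R}^N/\mathbf{Z}^N$; functions on $\mathbf{T}^N$ are identified with $\mathbf{Z}^N$-periodic functions on $\mathbf{R}^N$ (so $H(x/\varepsilon,p)$ makes sense for $x\in\mathbf{R}^N$). $D$ denotes the gradient in $x$. Viscosity solutions of the Cauchy problem are understood in the usual sense; existence and uniqueness of the bounded continuous viscosity solution $u^\varepsilon$ are known. *)

(* Defs.v *)
From HB Require Import structures.
From mathcomp Require Export all_boot all_order all_algebra.
From mathcomp Require Export all_classical all_reals all_analysis.
Export Order.TTheory GRing.Theory Num.Theory.
Export numFieldNormedType.Exports.

Set Implicit Arguments.
Unset Strict Implicit.
Unset Printing Implicit Defensive.

Local Open Scope classical_set_scope.
Local Open Scope ring_scope.

(* The library norm on 'rV[R]_N is the sup norm: it has the topology, the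
   bounded sets and the Lipschitz functions of the Euclidean norm, but not its
   values, and m(|p|) needs the latter. *)
Definition enorm (R : realType) (N : nat) (p : 'rV[R]_N) : R :=
  Num.sqrt (\sum_(i < N) p 0 i ^+ 2).

(* Functions on the torus T^N are Z^N-periodic functions on R^N. *)
Definition Zperiodic (R : realType) (N : nat) (f : 'rV[R]_N -> R) : Prop :=
  forall (k : 'rV[int]_N) (x : 'rV[R]_N), f (x + map_mx intr k) = f x.

Definition is_max_of (R : realType) (X : Type) (f : X -> R) (M : R) : Prop :=
  range f M /\ ubound (range f) M.

Definition is_min_of (R : realType) (X : Type) (f : X -> R) (M : R) : Prop :=
  range f M /\ lbound (range f) M.

(* Space-time points are pairs z = (x, t). *)
Definition open_cylinder (R : realType) (N : nat) (T : R) :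
    set ('rV[R]_N * R) := [set z | 0 < z.2 < T].

Definition cylinder (R : realType) (N : nat) (T : R) :
    set ('rV[R]_N * R) := [set z | 0 <= z.2 < T].

Definition dt (R : realType) (N : nat) (phi : 'rV[R]_N * R -> R)
    (z : 'rV[R]_N * R) : R :=
  'D_((0 : 'rV[R]_N), (1 : R)) phi z.

Definition Dx (R : realType) (N : nat) (phi : 'rV[R]_N * R -> R)
    (z : 'rV[R]_N * R) : 'rV[R]_N :=
  \row_(i < N) 'D_((delta_mx 0 i : 'rV[R]_N), (0 : R)) phi z.

(* In finite dimension, z |-> 'd phi z is continuous iff every
   z |-> 'D_v phi z is. *)
Definition C1_on (R : realType) (N : nat) (Q : set ('rV[R]_N * R))
    (phi : 'rV[R]_N * R -> R) : Prop :=
  (forall z, Q z -> differentiable phi z) /\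
  (forall v z, Q z -> {for z, continuous ('D_v phi)}).

(* Viscosity sub- and supersolutions of u_t + H(x, D u) = 0 in
   R^N x (0, T).  They are only used for continuous u, so that no
   semicontinuous envelopes are needed. *)
Definition viscosity_sub (R : realType) (N : nat) (T : R)
    (H : 'rV[R]_N -> 'rV[R]_N -> R) (u : 'rV[R]_N * R -> R) : Prop :=
  forall (phi : 'rV[R]_N * R -> R) (z : 'rV[R]_N * R),
    C1_on (open_cylinder T) phi -> open_cylinder T z ->
    (\forall w \near z, u w - phi w <= u z - phi z) ->
    dt phi z + H z.1 (Dx phi z) <= 0.

Definition viscosity_super (R : realType) (N : nat) (T : R)
    (H : 'rV[R]_N -> 'rV[R]_N -> R) (u : 'rV[R]_N * R -> R) : Prop :=
  forall (phi : 'rV[R]_N * R -> R) (z : 'rV[R]_N * R),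
    C1_on (open_cylinder T) phi -> open_cylinder T z ->
    (\forall w \near z, u z - phi z <= u w - phi w) ->
    0 <= dt phi z + H z.1 (Dx phi z).

(* Values of u outside R^N x [0, T) are irrelevant. *)
Definition bounded_viscosity_solution (R : realType) (N : nat) (T : R)
    (H : 'rV[R]_N -> 'rV[R]_N -> R) (u0 : 'rV[R]_N -> R)
    (u : 'rV[R]_N * R -> R) : Prop :=
  [/\ {within cylinder T, continuous u},
      [bounded u z | z in cylinder T],
      viscosity_sub T H u,
      viscosity_super T H u
    & forall x, u (x, 0) = u0 x].

(* R^N x [0, T) is locally compact, so locally uniform convergence on it is
   uniform convergence on its compact subsets. *)
Definition cvg_locally_uniformly (R : realType) (N : nat) (T : R)
    (u : R -> 'rV[R]_N * R -> R) (v : 'rV[R]_N * R -> R) : Prop :=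
  {family compactly_in (cylinder T), u eps @[eps --> 0^'+] --> v}.

(* Main.v *)
Require Import Defs.
From HB Require Import structures.
From mathcomp Require Import ring lra.

(** The oscillation of [sigma (x / eps)] is not averaged out.  Where [sigma] is
    minimal, [u_eps] decreases in time at rate at most about [sigma_min], because
    [m < 1]; where [sigma] is maximal, it decreases at rate at least
    [sigma_max * m 0], because [m >= m 0], whatever the gradient is.  Both facts
    follow by touching [u_eps] with
    [c t + K |x - y|^2 + eta / (T - t)]: a large [K] confines the contact point
    to a neighbourhood of [y] where [sigma] is almost extremal, and the last term
    keeps it away from [t = T].  Since [sigma_min < sigma_max * m 0], at a fixed
    positive time the values of [u_eps] at two points at distance [O(eps)] differ
    by a fixed amount.  This is impossible if [u_eps] converges uniformly near
    [x = 0], as the limit would be continuous there. *)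

Local Open Scope classical_set_scope.
Local Open Scope ring_scope.

Section Barrier.
Set Implicit Arguments.
Unset Strict Implicit.
Context {R : realType} {N : nat}.
Notation V := ('rV[R]_N * R)%type.
Implicit Types (Q : set V) (f g : V -> R) (z v : V).

(** * Closure properties of [C1_on] *)

Lemma C1_on_subset Q Q' f : Q `<=` Q' -> C1_on Q' f -> C1_on Q f.
Proof. by move=> QQ' [df cf]; split=> [z /QQ' /df|v z /QQ' /(cf v)]. Qed.

Lemma C1_on_continuous Q f z : C1_on Q f -> Q z -> {for z, continuous f}.
Proof. by move=> [df _] /df /differentiable_continuous. Qed.

Lemma C1_on_derivable Q f z v : C1_on Q f -> Q z -> derivable f z v.
Proof. by move=> [df _] /df /diff_derivable. Qed.

(** Continuity at [z] depends only on the values near [z], and [Q] open makes the formula for the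
    derivative valid on a whole neighbourhood. *)
Lemma derive_continuous_on Q f (df : V -> V -> R) : open Q ->
  (forall v z, Q z -> 'D_v f z = df v z) ->
  (forall v z, Q z -> {for z, continuous (df v)}) ->
  forall v z, Q z -> {for z, continuous ('D_v f)}.
Proof.
move=> oQ fE cdf v z Qz.
rewrite /prop_for /continuous_at fE//.
apply: cvg_trans (cdf v z Qz); apply: near_eq_cvg.
by near=> w; rewrite fE//; near: w; exact: open_nbhs_nbhs (conj oQ Qz).
Unshelve. all: by end_near. Qed.

Lemma C1_on_cst Q (a : R) : C1_on Q (cst a).
Proof.
split=> [z _|v z _]; first exact: differentiable_cst.
rewrite (_ : 'D_v _ = cst 0); first exact: cst_continuous.
by apply/funext => w; rewrite derive_cst.
Qed.

Lemma C1_on_linear Q (f : {linear V -> R}) : continuous f -> C1_on Q f.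
Proof.
move=> cf; split=> [z _|v z _]; first exact: linear_differentiable.
rewrite (_ : 'D_v _ = cst (f v)); first exact: cst_continuous.
by apply/funext => w; rewrite deriveE ?diff_lin//; exact: linear_differentiable.
Qed.

Lemma C1_onD Q f g : open Q -> C1_on Q f -> C1_on Q g -> C1_on Q (f + g).
Proof.
move=> oQ Cf Cg; split=> [z Qz|].
  by apply: differentiableD; [apply: Cf.1|apply: Cg.1].
apply: (derive_continuous_on (df := fun v => 'D_v f + 'D_v g) oQ) => v z Qz.
  by rewrite deriveD//; [apply: C1_on_derivable Cf Qz|apply: C1_on_derivable Cg Qz].
by apply: continuousD; [apply: Cf.2|apply: Cg.2].
Qed.

Lemma C1_onM Q f g : open Q -> C1_on Q f -> C1_on Q g -> C1_on Q (f * g).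
Proof.
move=> oQ Cf Cg; split=> [z Qz|].
  by apply: differentiableM; [apply: Cf.1|apply: Cg.1].
apply: (derive_continuous_on (df := fun v => f * 'D_v g + g * 'D_v f) oQ) => v z Qz.
  by rewrite deriveM//; [apply: C1_on_derivable Cf Qz|apply: C1_on_derivable Cg Qz].
have cf := C1_on_continuous Cf Qz; have cg := C1_on_continuous Cg Qz.
have [cdf cdg] := (Cf.2 v z Qz, Cg.2 v z Qz).
exact: continuousD (continuousM cf cdg) (continuousM cg cdf).
Qed.

Lemma C1_onN Q f : open Q -> C1_on Q f -> C1_on Q (- f).
Proof.
move=> oQ Cf; rewrite (_ : - f = cst (-1) * f).
  exact: C1_onM oQ (C1_on_cst Q (-1)) Cf.
by apply/funext => z /=; rewrite !fctE mulN1r.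
Qed.

Lemma C1_onV Q f : open Q -> (forall z, Q z -> f z != 0) -> C1_on Q f ->
  C1_on Q (fun z => (f z)^-1).
Proof.
move=> oQ f0 Cf; split=> [z Qz|].
  by apply: differentiableV; [apply: Cf.1|apply: f0].
apply: (derive_continuous_on
  (df := fun v z => - ((f z)^-1 * (f z)^-1) * 'D_v f z) oQ) => v z Qz.
  rewrite deriveV ?f0//; last exact: C1_on_derivable Cf Qz.
  by rewrite expr2 invfM.
have cV := continuousV (f0 z Qz) (C1_on_continuous Cf Qz).
exact: continuousM (continuousN (continuousM cV cV)) (Cf.2 v z Qz).
Qed.

Lemma C1_on_sum Q n (h : 'I_n -> V -> R) : open Q ->
  (forall i, C1_on Q (h i)) -> C1_on Q (\sum_(i < n) h i).
Proof.
move=> oQ Ch; elim/big_ind : _ => [|f g Cf Cg|i _]; last exact: Ch.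
  exact: (C1_on_cst Q 0).
exact: C1_onD.
Qed.

Lemma C1_on_snd Q : C1_on Q snd.
Proof. by apply: (@C1_on_linear Q snd) => z; exact: cvg_snd. Qed.

Lemma C1_on_coord Q i : C1_on Q (fun z => z.1 0 i).
Proof.
pose f : V -> R := fun z => z.1 0 i.
have lf : linear f by move=> k x y; rewrite /f /= !mxE.
pose F : {linear V -> R} := HB.pack f (GRing.isLinear.Build _ _ _ _ _ lf).
apply: (@C1_on_linear Q F) => z.
apply: (@continuous_comp V _ R fst (fun x => x 0 i) z); first exact: cvg_fst.
exact: coord_continuous.
Qed.

(** * The barrier: regularity and time derivative *)

Definition sqdist (y x : 'rV[R]_N) : R := \sum_(i < N) (x 0 i - y 0 i) ^+ 2.

Lemma sqdist_ge0 y x : 0 <= sqdist y x.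
Proof. by apply: sumr_ge0 => i _; exact: sqr_ge0. Qed.

Lemma sqdistxx x : sqdist x x = 0.
Proof. by rewrite /sqdist big1// => i _; rewrite subrr expr0n. Qed.

(** The sup norm is at most the Euclidean one, so a point at sup distance [rho] from [y] pays at
    least [K * rho ^+ 2] in the barrier. *)
Lemma sqr_norm_le_sqdist y x : `|x - y| ^+ 2 <= sqdist y x.
Proof.
rewrite -[leRHS]sqr_sqrtr ?sqdist_ge0// lerXn2r ?nnegrE ?sqrtr_ge0//.
rewrite [leLHS]/Num.norm/= mx_normrE.
apply/bigmax_leP; split=> [|[i j] _ /=]; first exact: sqrtr_ge0.
rewrite -sqrtr_sqr ler_wsqrtr// !mxE ord1 /sqdist (bigD1 j)//= lerDl.
by apply: sumr_ge0 => k _; exact: sqr_ge0.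
Qed.

(** At [z.2 = T] the inverse takes the default value 0 instead of blowing up, so regularity is only
    claimed on [z.2 < T]. *)
Definition barrier (c K eta T : R) (y : 'rV[R]_N) (z : V) : R :=
  c * z.2 + K * sqdist y z.1 + eta * (T - z.2)^-1.

Lemma open_before (T : R) : open [set z : V | z.2 < T].
Proof.
apply: (@open_comp _ _ snd [set t : R | t < T]); last exact: open_lt.
by move=> z _; exact: cvg_snd.
Qed.

Lemma C1_on_sqdist Q y : open Q -> C1_on Q (fun z : V => sqdist y z.1).
Proof.
move=> oQ.
rewrite (_ : (fun _ => _) = \sum_(i < N) (fun z : V => (z.1 0 i - y 0 i) ^+ 2)).
  apply: C1_on_sum => // i.
  have C : C1_on Q ((fun z : V => z.1 0 i) + cst (- y 0 i)).
    exact: C1_onD oQ (C1_on_coord _ i) (C1_on_cst _ _).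
  rewrite (_ : (fun _ => _) = ((fun z : V => z.1 0 i) + cst (- y 0 i)) *
                              ((fun z : V => z.1 0 i) + cst (- y 0 i))).
    exact: C1_onM.
  by apply/funext => z; rewrite !fctE expr2.
by apply/funext => z; rewrite fct_sumE.
Qed.

Lemma C1_on_horizon (T : R) :
  C1_on [set z : V | z.2 < T] (fun z => T - z.2).
Proof.
have oT := @open_before T.
exact: C1_onD oT (C1_on_cst _ T) (C1_onN oT (C1_on_snd _)).
Qed.

Lemma C1_on_inv_horizon (T : R) :
  C1_on [set z : V | z.2 < T] (fun z => (T - z.2)^-1).
Proof.
apply: C1_onV; [exact: open_before| |exact: C1_on_horizon].
by move=> z /= zT; rewrite subr_eq0 gt_eqF.
Qed.

Lemma barrierE c K eta T y : barrier c K eta T y =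
  cst c * snd + cst K * (fun z => sqdist y z.1) + cst eta * (fun z => (T - z.2)^-1).
Proof. by []. Qed.

Lemma C1_on_barrier c K eta T y :
  C1_on [set z : V | z.2 < T] (barrier c K eta T y).
Proof.
have oT := @open_before T.
have Cc k : C1_on [set z : V | z.2 < T] (cst k) := C1_on_cst _ k.
rewrite barrierE; apply: (C1_onD oT (C1_onD oT _ _) _).
- exact: C1_onM oT (Cc c) (C1_on_snd _).
- exact: C1_onM oT (Cc K) (C1_on_sqdist y oT).
- exact: C1_onM oT (Cc eta) (C1_on_inv_horizon _).
Qed.

Lemma dt_space (f : 'rV[R]_N -> R) (z : V) : dt (fun z => f z.1) z = 0.
Proof.
rewrite /dt /derive (_ : (fun h => _) = cst 0) ?lim_cst//.
by apply/funext => h /=; rewrite scaler0 add0r subrr scaler0.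
Qed.

Lemma dt_snd (z : V) : dt snd z = 1.
Proof.
have cs : continuous (snd : V -> R) by move=> w; exact: cvg_snd.
rewrite /dt deriveE; last exact: linear_differentiable.
by rewrite (diff_lin z cs).
Qed.

Lemma dt_barrier c K eta T y (z : V) : z.2 < T ->
  dt (barrier c K eta T y) z = c + eta / (T - z.2) ^+ 2.
Proof.
move=> zT; have T0 : T - z.2 != 0 by rewrite subr_eq0 gt_eqF.
pose e := ((0 : 'rV[R]_N), (1 : R)).
have Ds : is_derive z e (snd : V -> R) 1.
  by apply: DeriveDef (dt_snd z); exact: C1_on_derivable (C1_on_snd [set z | z.2 < T]) zT.
have Dd : is_derive z e (fun z : V => sqdist y z.1) 0.
  apply: DeriveDef (dt_space (sqdist y) z).
  exact: C1_on_derivable (C1_on_sqdist y (@open_before T)) zT.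
have Dh : is_derive z e (fun z : V => T - z.2) (0 - 1).
  exact: is_deriveB (is_derive_cst T z e) Ds.
have Di : is_derive z e (fun z : V => (T - z.2)^-1) ((T - z.2) ^- 2).
  apply: DeriveDef; first exact: C1_on_derivable (C1_on_inv_horizon T) zT.
  rewrite deriveV; [|exact: T0|exact: (@ex_derive _ _ _ _ _ _ _ Dh)].
  by rewrite (@derive_val _ _ _ _ _ _ _ Dh) sub0r scalerN scaleNr opprK [LHS]mulr1.
have Db := is_deriveD (is_deriveD (is_deriveZ c Ds) (is_deriveZ K Dd)) (is_deriveZ eta Di).
have -> : dt (barrier c K eta T y) z = _ := @derive_val _ _ _ _ _ _ _ Db.
by rewrite scaler0 addr0 [c *: _]mulr1.
Qed.

(** * Comparison with the barrier *)

Lemma compact_box (y : 'rV[R]_N) (rho a b : R) : 0 < rho ->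
  compact ([set x | `|y - x| <= rho] `*` `[a, b]).
Proof.
move=> rho0; apply: compact_setX; last exact: segment_compact.
apply: bounded_closed_compact.
  exists (`|y| + rho); split=> [|M ltM x /= yx]; first exact: num_real.
  by rewrite -(subKr y x) (le_trans (ler_normB _ _))// (le_trans _ (ltW ltM))// lerD2l.
have := @closed_ball_closed R _ y rho.
by rewrite closed_ballE.
Qed.

Lemma within_cylinder_near (T : R) (W : V -> R) (x : 'rV[R]_N) (t k : R) :
  {within cylinder T, continuous W} -> 0 <= t < T -> 0 < k ->
  exists2 d, 0 < d & forall x', `|x - x'| < d -> `|W (x, t) - W (x', t)| < k.
Proof.
move=> /subspace_continuousP /(_ (x, t)) cW tT k0.
have /cvgrPdist_lt /(_ _ k0) := cW tT.
rewrite near_withinE => /nbhs_ballP[d /= d0 H]; exists d => // x' xx'.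
apply: H => //; split => /=; last exact: ballxx.
by rewrite -ball_normE.
Qed.

(** If the bound fails at [t], the minimum of [W + barrier] over a compact box is too low to lie on
    the initial, lateral or top face. It is then an interior local minimum, which [untouched]
    forbids. A general [W] serves both the solution and its opposite. *)
Lemma barrier_comparison (T B c r : R) (y : 'rV[R]_N) (W : V -> R) :
  {within cylinder T, continuous W} ->
  (forall z, cylinder T z -> `|W z| <= B) -> 0 < r ->
  (forall K eta z, 0 < eta -> open_cylinder T z -> `|y - z.1| < r ->
     ~ \forall w \near z, W z + barrier c K eta T y z <=
                          W w + barrier c K eta T y w) ->
  forall t, 0 <= t < T -> W (y, 0) - c * t <= W (y, t).
Proof.
move=> cW WB r0 untouched t /andP[t0 tT]; rewrite leNgt; apply/negP => Wlt.
(* The deficit is [3 * k]: one [k] pays for the [eta] term at time [t], one for the oscillation of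
   [W] at time 0, one is the margin. *)
pose k := (W (y, 0) - c * t - W (y, t)) / 3.
have k0 : 0 < k by rewrite /k; lra.
have T0 : 0 < T by exact: le_lt_trans tT.
have [d d0 Wd] := @within_cylinder_near T W y 0 k cW (introT andP (conj (lexx 0) T0)) k0.
pose rho := Num.min d r / 2.
have rho0 : 0 < rho by rewrite /rho divr_gt0// lt_min d0.
have [rhod rhor] : rho < d /\ rho < r.
  have : Num.min d r <= d by rewrite ge_min lexx.
  have : Num.min d r <= r by rewrite ge_min lexx orbT.
  by rewrite /rho; lra.
(* A penalty [M] outweighs any variation of [W] and of the linear term, plus the cost [k]; the final
   1 gives strictness. *)
pose M := 2 * B + 2 * (`|c| * T) + k + 1.
have B0 : 0 <= B by apply: le_trans (WB (y, t) _); rewrite //= /cylinder/= t0.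
have cT0 : 0 <= `|c| * T by rewrite mulr_ge0// ltW.
have kM : k < M by rewrite /M; lra.
have M0 : 0 < M by exact: lt_trans kM.
have cs s : 0 <= s <= T -> - (`|c| * T) <= c * s <= `|c| * T.
  move=> /andP[s0 sT]; rewrite -ler_norml normrM ler_wpM2l//.
  by rewrite ger0_norm.
pose eta := k * (T - t).
have eta0 : 0 < eta by rewrite mulr_gt0// subr_gt0.
(* At [t1] the singular term equals [M]; it equals [k < M] at [t], whence [t < t1]. *)
pose t1 := T - eta / M.
have etaM : 0 < eta / M by rewrite divr_gt0.
have t1T : t1 < T by rewrite /t1; lra.
have tt1 : t < t1.
  rewrite /t1 ltrBrDr -ltrBrDl /eta ltr_pdivrMr// mulrC ltr_pM2l ?subr_gt0//.
(* Chosen so that the lateral face costs at least [M]. *)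
pose K := M / rho ^+ 2.
have K0 : 0 < K by rewrite divr_gt0// exprn_gt0.
pose b := barrier c K eta T y.
pose f := W + b.
pose box := [set x | `|y - x| <= rho] `*` `[0, t1]%classic.
have box_cyl : box `<=` cylinder T.
  move=> z [_ /=]; rewrite in_itv/= => /andP[z0 z1].
  by rewrite /cylinder/= z0 (le_lt_trans z1).
have boxy s : 0 <= s <= t1 -> box (y, s).
  by move=> s01; split; rewrite /= ?subrr ?normr0 ?in_itv//= ltW.
have [] := @compact_EVT_min V R f box.
- by exists (y, t); apply: boxy; rewrite t0 ltW.
- exact: compact_box.
- have cWb : {within box, continuous W} := continuous_subspaceW box_cyl cW.
  have cb : {within box, continuous b}.
    apply: continuous_in_subspaceT => w /set_mem /box_cyl /andP[_ wT].
    exact: C1_on_continuous (C1_on_barrier c K eta T y) wT.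
  by move=> z; exact: continuousD (cWb z) (cb z).
move=> z; rewrite inE => zbox zmin.
have fyt : f (y, t) = W (y, 0) - 2 * k.
  rewrite /f /b /barrier !fctE/= sqdistxx mulr0 addr0 /eta mulfK ?subr_eq0 ?gt_eqF//.
  by rewrite /k; field.
have fz : f z <= W (y, 0) - 2 * k.
  by rewrite -fyt; apply: zmin; rewrite inE; apply: boxy; rewrite t0 ltW.
have zcyl := box_cyl z zbox.
have [/= zrho] := zbox; rewrite in_itv/= => /andP[z0 zt1].
have zT : z.2 < T by exact: le_lt_trans t1T.
have etaz : 0 < eta / (T - z.2) by rewrite divr_gt0// subr_gt0.
have Kz : 0 <= K * sqdist y z.1 by rewrite mulr_ge0 ?sqdist_ge0 ?ltW.
have fE : f z = W z + (c * z.2 + K * sqdist y z.1 + eta / (T - z.2)) by [].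
have := WB _ zcyl; rewrite ler_norml => /andP[WzB _].
have : `|W (y, t)| <= B by apply: WB; rewrite /cylinder/= t0.
rewrite ler_norml => /andP[_ WytB].
have /cs/andP[cz _] : 0 <= z.2 <= T by rewrite z0 ltW.
have /cs/andP[_ ct] : 0 <= t <= T by rewrite t0 ltW.
(* On the initial face, [W] exceeds [W (y, 0) - k] because [rho < d], and the barrier is nonnegative
   there. *)
have zpos : 0 < z.2.
  rewrite lt_neqAle z0 andbT eq_sym; apply/eqP => z20.
  have := Wd z.1 (le_lt_trans zrho rhod).
  have <- : z = (z.1, 0) by rewrite -z20 -surjective_pairing.
  rewrite ltr_norml => /andP[_]; have : c * z.2 = 0 by rewrite z20 mulr0.
  by move: fz; rewrite fE; lra.
have zlat : `|y - z.1| < rho.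
  rewrite lt_neqAle zrho andbT; apply/eqP => zE.
  have : M <= K * sqdist y z.1.
    rewrite /K mulrAC ler_pdivlMr ?exprn_gt0// (ler_wpM2l (ltW M0))// -zE distrC.
    exact: sqr_norm_le_sqdist.
  by move: fz; rewrite fE /M /k; lra.
have ztop : z.2 < t1.
  rewrite lt_neqAle zt1 andbT; apply/eqP => zE.
  have etazM : eta / (T - z.2) = M.
    by rewrite zE /t1 subKr invf_div mulrC divfK ?gt_eqF.
  by move: fz; rewrite fE etazM /M /k; lra.
apply: (untouched K eta z eta0); rewrite /open_cylinder/= ?zpos//.
  exact: lt_trans rhor.
(* All faces being excluded, the box is a neighbourhood of [z], so the minimum over the box is a
   local one. *)
have near_lat : \forall w \near z, `|y - w.1| < rho.
  have : \forall x \near z.1, ball y rho x.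
    by apply: open_nbhs_nbhs; split; [exact: ball_open|rewrite -ball_normE].
  by rewrite -ball_normE => /(@cvg_fst _ _ _ (nbhs z.2) _).
have near_t : \forall w \near z, 0 < w.2 < t1.
  have : \forall s \near z.2, s \in `]0, t1[ by apply: near_in_itvoo; rewrite in_itv/= zpos.
  by move=> /(@cvg_snd _ _ (nbhs z.1) _ _).
near=> w; apply: zmin; rewrite inE; split=> /=.
  by apply: ltW; near: w.
have /andP[w0 w1] : 0 < w.2 < t1 by near: w.
by rewrite in_itv/= !ltW.
Unshelve. all: by end_near. Qed.

(** * Uniform closeness on compact sets and scaling *)

Lemma cvg_locally_uniformly_near (T k : R) (C : set V) (u : R -> V -> R)
    (v : V -> R) :
  cvg_locally_uniformly T u v -> C `<=` cylinder T -> compact C -> 0 < k ->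
  \forall eps \near 0^'+, forall z, C z -> `|v z - u eps z| < k.
Proof.
move=> /fam_cvgP uv CT cC k0.
have vk : nbhs (v : {uniform` C -> R}) [set h | forall z, C z -> `|v z - h z| < k].
  apply/uniform_nbhs; exists [set xy : R * R | ball xy.1 k xy.2].
  split=> [|h Ch z Cz]; first by rewrite -entourage_ballE; exists k.
  by have /= := Ch z Cz; rewrite -ball_normE.
exact: uv C (conj CT cC) _ vk.
Qed.

Lemma scaler_near0 (d : R) (y : 'rV[R]_N) : 0 < d ->
  \forall eps \near 0^'+, `|0 - eps *: y| < d.
Proof.
(* Adding 1 keeps the divisor positive when [y = 0]. *)
move=> d0; have y1 : 0 < `|y| + 1 by rewrite ltr_wpDl.
near=> e.
have e0 : 0 < e by near: e; exact: nbhs_right_gt.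
have : e < d / (`|y| + 1) by near: e; apply: nbhs_right_lt; rewrite divr_gt0.
rewrite ltr_pdivlMr// sub0r normrN normrZ gtr0_norm//.
by apply: le_lt_trans; rewrite ler_pM2l// lerDl.
Unshelve. all: by end_near. Qed.

(** The radius is [e] times a continuity radius of [sigma] at [y]. Its dependence on [e] is
    harmless, since [barrier_comparison] accepts any positive [r]. *)
Lemma scaled_continuous_near (sigma : 'rV[R]_N -> R) (e : R) (y : 'rV[R]_N) (k : R) :
  continuous sigma -> 0 < e -> 0 < k ->
  exists2 r, 0 < r & forall x, `|e *: y - x| < r ->
    `|sigma y - sigma (e^-1 *: x)| < k.
Proof.
move=> cs e0 k0; have /cvgrPdist_lt /(_ _ k0) := cs y.
move=> /nbhs_ballP[d /= d0 H]; exists (e * d); first exact: mulr_gt0.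
move=> x xr; apply: H; rewrite -ball_normE/=.
rewrite -(ltr_pM2l e0) -[X in X * `|_|](gtr0_norm e0) -normrZ scalerBr scalerA.
by rewrite divff ?gt_eqF// scale1r.
Qed.

End Barrier.

(** * One-sided bounds on the decay of the solution *)

Section Solution.
Set Implicit Arguments.
Unset Strict Implicit.
Context {R : realType} {N : nat}.
Notation V := ('rV[R]_N * R)%type.
Context (sigma : 'rV[R]_N -> R) (m : R -> R) (T e : R)
  (u0 : 'rV[R]_N -> R) (u : V -> R)
  (sigma_cont : continuous sigma) (sigma_pos : forall x, 0 < sigma x)
  (m_range : forall r, 0 <= r -> 0 < m r < 1)
  (m_incr : forall r s, 0 <= r -> r < s -> m r < m s)
  (e0 : 0 < e)
  (u_sol : bounded_viscosity_solution T
     (fun x p => sigma (e^-1 *: x) * m (enorm p)) u0 u).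

Lemma bounded_on_cylinder : exists B, forall z, cylinder T z -> `|u z| <= B.
Proof.
have [_ [M [_ H]] _ _ _] := u_sol; exists (M + 1) => z zT.
by apply: H => //; rewrite ltrDl.
Qed.

Lemma open_cylinder_before : open_cylinder T `<=` [set z : V | z.2 < T].
Proof. by move=> z /andP[]. Qed.

(** The [eta] term makes the inequality strict, so contact contradicts the viscosity inequality. *)
Lemma barrier_rate c K eta y (z : V) : 0 < eta -> open_cylinder T z ->
  c < dt (barrier c K eta T y) z.
Proof.
move=> eta0 /andP[_ zT]; rewrite dt_barrier// ltrDl divr_gt0// exprn_gt0//.
by rewrite subr_gt0.
Qed.

(** If [- b] touches [u] from below near [e *: y], the supersolution property gives [dt b z <= sigma
    (e^-1 *: z.1) * m (enorm p) < c], using [m < 1] for whatever gradient [p]; but [dt b z > c]. *)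
Lemma solution_ge (y : 'rV[R]_N) (c t : R) : sigma y < c -> 0 <= t < T ->
  u0 (e *: y) - c * t <= u (e *: y, t).
Proof.
move=> yc tT; have [cu _ _ super init] := u_sol.
have [B uB] := bounded_on_cylinder.
have cy : 0 < c - sigma y by rewrite subr_gt0.
have [r r0 near_y] := scaled_continuous_near y sigma_cont e0 cy.
rewrite -init; apply: (barrier_comparison cu uB r0) tT.
move=> K eta z eta0 zT yz minz.
pose b : V -> R := barrier c K eta T (e *: y).
have Cb : C1_on (open_cylinder T) b.
  exact: C1_on_subset open_cylinder_before (C1_on_barrier c K eta T (e *: y)).
have CNb : C1_on (open_cylinder T) (- b).
  apply: C1_on_subset open_cylinder_before _.
  exact: C1_onN (@open_before _ _ T) (C1_on_barrier c K eta T (e *: y)).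
have := super (- b) z CNb zT.
have -> : dt (- b) z = - dt b z by rewrite /dt deriveN//; exact: C1_on_derivable Cb zT.
have minz' : \forall w \near z, u z - (- b) z <= u w - (- b) w.
  by apply: filterS minz => w; rewrite /b !fctE !opprK.
move=> /(_ minz'); rewrite addrC subr_ge0 leNgt => /negP; apply.
have := barrier_rate c K (e *: y) eta0 zT; rewrite -/b => ltc.
have := near_y z.1 yz; rewrite ltr_norml => /andP[szc _].
set p := Dx _ _; have /andP[m0 m1] := m_range (sqrtr_ge0 _ : 0 <= enorm p).
rewrite (lt_trans _ ltc)// (@le_lt_trans _ _ (sigma (e^-1 *: z.1)))//.
  by rewrite ler_piMr// ltW.
by move: szc; lra.
Qed.

(** Comparison is applied to [- u] with rate [- c]. At a contact point the Hamiltonian is at least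
    [sigma (e^-1 *: z.1) * m 0 > c] while [dt b z > - c], against the subsolution property. *)
Lemma solution_le (y : 'rV[R]_N) (c t : R) : c < sigma y * m 0 -> 0 <= t < T ->
  u (e *: y, t) <= u0 (e *: y) - c * t.
Proof.
move=> yc tT; have [cu _ sub _ init] := u_sol.
have [B uB] := bounded_on_cylinder.
have /andP[m00 m01] := m_range (lexx 0).
have cy : 0 < sigma y - c / m 0 by rewrite subr_gt0 ltr_pdivrMr.
have [r r0 near_y] := scaled_continuous_near y sigma_cont e0 cy.
have NuB z : cylinder T z -> `|(- u) z| <= B by move=> /uB; rewrite fctE normrN.
have cNu : {within cylinder T, continuous (- u)}.
  by move=> z; exact: continuousN (cu z).
rewrite -lerN2 opprB addrC -init -[c * t]opprK -mulNr.
apply: (@barrier_comparison _ _ T B (- c) r (e *: y) (- u) cNu NuB r0) tT.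
move=> K eta z eta0 zT yz minz.
pose b : V -> R := barrier (- c) K eta T (e *: y).
have Cb : C1_on (open_cylinder T) b.
  exact: C1_on_subset open_cylinder_before (C1_on_barrier (- c) K eta T (e *: y)).
have maxz : \forall w \near z, u w - b w <= u z - b z.
  by apply: filterS minz => w; rewrite -/b !fctE -lerN2 !opprD !opprK.
have := sub b z Cb zT maxz; rewrite leNgt => /negP; apply.
have := barrier_rate (- c) K (e *: y) eta0 zT; rewrite -/b => ltc.
have := near_y z.1 yz; rewrite ltr_norml => /andP[_ szc].
set p := Dx _ _.
have mp : m 0 <= m (enorm p).
  have : 0 <= enorm p := sqrtr_ge0 _.
  by rewrite le_eqVlt => /predU1P[<-//|/(m_incr (lexx 0))/ltW].
have : c < sigma (e^-1 *: z.1) * m (enorm p); last by move: ltc; lra.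
apply: (@lt_le_trans _ _ (sigma (e^-1 *: z.1) * m 0)); last by rewrite ler_wpM2l// ltW.
by rewrite -ltr_pdivrMr//; move: szc; lra.
Qed.

End Solution.

Theorem theorem5p4 (R : realType) (N : nat)
  (sigma : 'rV[R]_N -> R) (m : R -> R) (sigma_max sigma_min T : R)
  (u0 : 'rV[R]_N -> R) (u : R -> 'rV[R]_N * R -> R)
  (sigma_cont : continuous sigma)
  (sigma_per : Zperiodic sigma)
  (sigma_pos : forall x, 0 < sigma x)
  (m_lip : [lipschitz m r | r in `[0, +oo[])
  (m_range : forall r, 0 <= r -> 0 < m r < 1)
  (m_incr : forall r s, 0 <= r -> r < s -> m r < m s)
  (m_lim : m r @[r --> +oo] --> (1 : R))
  (sigma_maxP : is_max_of sigma sigma_max)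
  (sigma_minP : is_min_of sigma sigma_min)
  (gap : sigma_min < sigma_max * m 0)
  (T_gt0 : 0 < T)
  (u0_bnd : bounded_fun u0)
  (u0_lip : lipschitz u0)
  (u_sol : forall eps, 0 < eps ->
     bounded_viscosity_solution T
       (fun x p => sigma (eps^-1 *: x) * m (enorm p)) u0 (u eps)) :
  ~ exists v : 'rV[R]_N * R -> R, cvg_locally_uniformly T u v.
Proof.
move=> [v uv].
have [[y1 _ y1E] _] := sigma_minP; have [[y2 _ y2E] _] := sigma_maxP.
pose th := sigma_max * m 0 - sigma_min; have th0 : 0 < th by rewrite subr_gt0.
pose t := T / 2; have t0 : 0 < t by rewrite divr_gt0.
have tT : 0 <= t < T by rewrite /t; lra.
have T0 : 0 <= (0 : R) < T by rewrite lexx.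
(* After a loss of [th / 3] in each rate, the two decays at time [t] still differ by
   [th * t / 3 = 10 * k]; the closeness estimates below cost only [8 * k]. *)
pose k := th * t / 30; have k0 : 0 < k by rewrite divr_gt0 ?mulr_gt0.
pose C := [set x : 'rV[R]_N | `|0 - x| <= 1] `*` `[t, t]%classic.
have C_cyl : C `<=` cylinder T.
  by move=> z [_ /=]; rewrite in_itv/= -eq_le => /eqP zt; rewrite /cylinder/= -zt.
have uvk := cvg_locally_uniformly_near uv C_cyl (compact_box ltr01) k0.
(* A first scale [e1] is frozen: [u e1] is continuous and close to [v], so it stands in for the
   continuity of the limit. The second scale [e] is chosen afterwards, from the continuity radii of
   [u e1]. *)
have [e1 [e1_gt0 uve1]] : exists e1, 0 < e1 /\ forall z, C z -> `|v z - u e1 z| < k.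
  near (0 : R)^'+ => e1; exists e1; split; last by near: e1.
  by near: e1; exact: nbhs_right_gt.
have [cu1 _ _ _ init1] := u_sol e1 e1_gt0.
have [d d0 ud] := within_cylinder_near 0 cu1 tT k0.
(* At time 0 this yields the continuity of [u0] at the origin. *)
have [d' d'0 ud'] := within_cylinder_near 0 cu1 T0 k0.
pose r := Num.min 1 (Num.min d d').
have r0 : 0 < r by rewrite !lt_min ltr01 d0.
have [e [e0 uve y1r y2r]] : exists e, [/\ 0 < e, forall z, C z -> `|v z - u e z| < k,
    `|0 - e *: y1| < r & `|0 - e *: y2| < r].
  near (0 : R)^'+ => e; exists e; split; near: e => //; first exact: nbhs_right_gt.
    exact: scaler_near0.
  exact: scaler_near0.
(* Three errors [k]: from [u e] to [v], from [v] to [u e1], and from [e *: y] to 0 in [u e1]. *)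
have close y : `|0 - e *: y| < r ->
    `|u e (e *: y, t) - u e1 (0, t)| < 3 * k /\ `|u0 0 - u0 (e *: y)| < k.
  rewrite !lt_min => /and3P[yr1 yrd yrd']; split; last by rewrite -!init1; exact: ud'.
  have Cy : C (e *: y, t) by split; rewrite /= ?in_itv/= ?lexx// ltW.
  have := uve _ Cy; have := uve1 _ Cy; have := ud _ yrd.
  rewrite !ltr_norml => /andP[? ?] /andP[? ?] /andP[? ?]; apply/andP; split; lra.
have [u1 v1] := close y1 y1r; have [u2 v2] := close y2 y2r.
have lo : u0 (e *: y1) - (sigma_min + th / 3) * t <= u e (e *: y1, t).
  apply: (solution_ge sigma_cont sigma_pos m_range e0 (u_sol e e0)) tT.
  by rewrite y1E ltrDl divr_gt0.
have hi : u e (e *: y2, t) <= u0 (e *: y2) - (sigma_max * m 0 - th / 3) * t.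
  apply: (solution_le sigma_cont sigma_pos m_range m_incr e0 (u_sol e e0)) tT.
  by rewrite y2E ltrBlDr ltrDl divr_gt0.
have E1 : (sigma_max * m 0 - th / 3) * t - (sigma_min + th / 3) * t = 10 * k.
  by rewrite /k /th; field.
(* The values of [u e] at the two points differ by less than [6 * k], yet [lo] and [hi] force more
   than [10 * k - 2 * k]. *)
move: u1 v1 u2 v2; rewrite !ltr_norml.
move=> /andP[? ?] /andP[? ?] /andP[? ?] /andP[? ?]; lra.
Unshelve. all: by end_near. Qed.
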